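(* Let $Q$ be a quantity space over $\mathbb{R}_{>0}$, let $\mathfrak{D},\mathfrak{D}_1,\ldots,\mathfrak{D}_m,\mathfrak{B}_1,\ldots,\mathfrak{B}_r$ be dimensions in $Q/{\sim}$ such that $\{\mathfrak{B}_1,\ldots,\mathfrak{B}_r\}$ is a maximal set of independent dimensions in the dimension group generated by $\mathfrak{D}_1,\ldots,\mathfrak{D}_m,\mathfrak{B}_1,\ldots,\mathfrak{B}_r$, and let $$\Psi:\mathfrak{D}_1\times\cdots\times\mathfrak{D}_m\times\mathfrak{B}_1\times\cdots\times\mathfrak{B}_r\to\mathfrak{D},\quad (p_1,\dots,p_m,q_1,\dots,q_r)\mapsto p$$ be a non-trivial quantity function with a covariant scalar representation $$\psi:\mathbb{R}_{>0}^{m+r}\to\mathbb{R}_{>0},\quad (s_1,\dots,s_m,t_1,\dots,t_r)\mapsto s.$$ Then there are integers $k>0,k_j$ and $c_i>0,c_{ij}$ for $i=1,\ldots,m$ and $j=1,\ldots,r$ such that there is (1) a quasiscalar function $\varPhi:[1_Q]\times\cdots\times[1_Q]\to[1_Q]$ ($m$ factors) such that $$p=\Psi(p_1,\dots,p_m,q_1,\dots,q_r)=\sqrt[k]{\prod_{j=1}^r q_j^{k_j}}\;\varPhi(\Pi_1,\ldots,\Pi_m)$$ for all arguments, where $\Pi_i=p_i^{c_i}/\bigl(\prod_{j=1}^r q_j^{c_{ij}}\bigr)$; (2) a scalar function $\varphi:\mathbb{R}_{>0}^m\to\mathbb{R}_{>0}$ such that $\psi$, defined by $$s=\psi(s_1,\dots,s_m,t_1,\dots,t_r)=\prod_{j=1}^r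 t_j^{k_j/k}\,\varphi(\pi_1,\ldots,\pi_m),$$ where $\pi_i=s_i^{c_i}/\bigl(\prod_{j=1}^r t_j^{c_{ij}}\bigr)$, is a covariant scalar representation of $\Psi$.
   Context: A scalable monoid over $\mathbb{R}_{>0}$ is a commutative monoid $Q$ (written multiplicatively, unit $1_Q$) with a map $\mathbb{R}_{>0}\times Q\to Q$, $(\alpha,q)\mapsto\alpha q$, such that $1q=q$, $\alpha(\beta q)=(\alpha\beta)q$, $\alpha(qq')=(\alpha q)q'$ for all $\alpha,\beta\in\mathbb{R}_{>0}$, $q,q'\in Q$. A basis for $Q$ is a finite set $B=\{b_1,\dots,b_n\}$ of invertible elements of $Q$ such that every $q\in Q$ has a unique expansion $q=\mu\prod_{i=1}^n b_i^{k_i}$ with $\mu\in\mathbb{R}_{>0}$, $k_i\in\mathbb{Z}$; the scalar $\mu$ is the measure $\mu_B(q)$ of $q$ relative to $B$. A quantity space over $\mathbb{R}_{>0}$ is a scalable monoid over $\mathbb{R}_{>0}$ with a finite basis (then every quantity is invertible). $q\sim q'$ means $\alpha q=\beta q'$ for some scalars $\alpha,\beta$; this is a congruence, its classes $[q]$ are called dimensions, and $Q/{\sim}$ with $[q][q']=[qq']$ is a free abelian group of finite rank. A dimension group is a subgroup of $Q/{\sim}$. Roots: if $\mathfrak{D}$ is a dimension, $k>0$ an integer and $\mathfrak{p}\in\mathfrak{D}^k$, there is a unique $p\in\mathfrak{D}$ with $p^k=\mathfrak{p}$, denoted $\sqrt[k]{\mathfrak{p}}$. A dimension $\mathfrak{d}$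 is dependent on $\mathfrak{d}_1,\dots,\mathfrak{d}_n$ if there are integers $k\neq0,k_1,\dots,k_n$ with $\mathfrak{d}^k=\prod_{i=1}^n\mathfrak{d}_i^{k_i}$ (an empty product is $[1_Q]$). $\{\mathfrak{d}_1,\dots,\mathfrak{d}_n\}$ is a set of independent dimensions if $\prod_{i=1}^n\mathfrak{d}_i^{k_i}=[1_Q]$ implies all $k_i=0$; it is a maximal set of independent dimensions in $\mathfrak{T}$ if it is contained in $\mathfrak{T}$, is independent, and every other element of $\mathfrak{T}$ is dependent on it. A quantity function is a function $\Phi:\mathfrak{E}_1\times\cdots\times\mathfrak{E}_N\to\mathfrak{E}$ with $\mathfrak{E},\mathfrak{E}_i\in Q/{\sim}$; it is trivial if it has the form $(q_1,\dots,q_N)\mapsto0q$ (impossible over $\mathbb{R}_{>0}$), and quasiscalar if all of $\mathfrak{E},\mathfrak{E}_i$ equal $[1_Q]$. A covariant scalar representation of $\Phi$ is a function $\phi:\mathbb{R}_{>0}^N\to\mathbb{R}_{>0}$ such that $\phi(\mu_B(q_1),\dots,\mu_B(q_N))=\mu_B(\Phi(q_1,\dots,q_N))$ for all $q_i\in\mathfrak{E}_i$ and every basis $B$ for $Q$. *)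

(* Defs.v *)
From HB Require Import structures.
From mathcomp Require Import all_boot all_order all_algebra generic_quotient.
From mathcomp Require Import all_classical all_reals all_analysis.

Set Implicit Arguments.
Unset Strict Implicit.
Unset Printing Implicit Defensive.

Import Order.TTheory GRing.Theory Num.Theory.

Local Open Scope ring_scope.
Local Open Scope group_scope.
Local Open Scope quotient_scope.
Local Open Scope classical_set_scope.

(* The scalars, the positive reals, are {posnum R}, for R : realType. *)

Definition scalar_prod (R : realType) (n : nat) (f : 'I_n -> {posnum R}) :
    {posnum R} :=
  @PosNum R (\prod_(i < n) (f i)%:num)%R
    (prodr_gt0 _ (fun i _ => [gt0 of (f i)%:num]%R)).

Definition scalar_expz (R : realType) (x : {posnum R}) (k : int) : {posnum R} :=
  @PosNum R (x%:num ^ k)%R (exprz_gt0 k [gt0 of x%:num]%R).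

HB.mixin Record Monoid_isScalable (R : realType) Q of monoid.Monoid Q := {
  scaleq : {posnum R} -> Q -> Q;
  mulqC : forall q q' : Q, q * q' = q' * q;
  scale1q : forall q : Q, scaleq (1%R)%:pos q = q;
  scaleqA : forall (a b : {posnum R}) (q : Q),
    scaleq a (scaleq b q) = scaleq ((a%:num * b%:num)%R)%:pos q;
  scaleqMl : forall (a : {posnum R}) (q q' : Q),
    scaleq a (q * q') = scaleq a q * q'
}.

#[short(type="scalableMonoidType")]
HB.structure Definition ScalableMonoid (R : realType) :=
  {Q of Monoid_isScalable R Q & monoid.Monoid Q}.

Section Powers.
Variable M : monoidType.

Definition invertible (x : M) := exists y : M, x * y = 1 /\ y * x = 1.

(* A monoid carries no inversion in the library: minv x is the inverse of x *)
(* when x is invertible, and 1 otherwise. *)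
Definition minv (x : M) : M := xget 1 [set y | x * y = 1 /\ y * x = 1].

Definition mexpz (x : M) (k : int) : M :=
  match k with Posz n => x ^+ n | Negz n => minv x ^+ n.+1 end.

Lemma minvP (x : M) : invertible x -> x * minv x = 1 /\ minv x * x = 1.
Proof. by rewrite /minv => -[y xy]; case: xgetP => [z _ //|/(_ y)]; case. Qed.

End Powers.

Notation "x ^z k" := (mexpz x k) (at level 29, left associativity) : group_scope.

Definition is_expansion (R : realType) (Q : scalableMonoidType R) (n : nat)
    (b : 'I_n -> Q) (q : Q) (e : {posnum R} * {ffun 'I_n -> int}) :=
  q = scaleq e.1 (\prod_(i < n) b i ^z e.2 i).

Record basis (R : realType) (Q : scalableMonoidType R) := Basis {
  basis_size : nat;
  basis_elt : 'I_basis_size -> Q;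
  basis_invertible : forall i, invertible (basis_elt i);
  basis_expansion : forall q : Q, exists! e, is_expansion basis_elt q e
}.

Definition measure_of (R : realType) (Q : scalableMonoidType R)
    (b : basis Q) (q : Q) : {posnum R} :=
  (projT1 (cid (basis_expansion b q))).1.

HB.mixin Record ScalableMonoid_hasBasis (R : realType) Q
    of ScalableMonoid R Q := {
  basis_exists : inhabited (basis Q)
}.

#[short(type="quantitySpaceType")]
HB.structure Definition QuantitySpace (R : realType) :=
  {Q of ScalableMonoid_hasBasis R Q & ScalableMonoid R Q}.

Section Dimensions.
Variables (R : realType) (Q : scalableMonoidType R).

Lemma scaleqC (a b : {posnum R}) (q : Q) :
  scaleq a (scaleq b q) = scaleq b (scaleq a q).
Proof. by rewrite !scaleqA; congr scaleq; apply/val_inj/mulrC. Qed.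

Lemma scaleqMr (a : {posnum R}) (q q' : Q) :
  scaleq a (q * q') = q * scaleq a q'.
Proof. by rewrite mulqC scaleqMl mulqC. Qed.

Definition simq (q q' : Q) : bool :=
  `[< exists a b : {posnum R}, scaleq a q = scaleq b q' >].

Lemma simq_refl : reflexive simq.
Proof. by move=> q; apply/asboolP; exists (1%R)%:pos, (1%R)%:pos. Qed.

Lemma simq_sym : symmetric simq.
Proof.
by move=> p q; apply/asboolP/asboolP => -[a [b ab]]; exists b, a.
Qed.

Lemma simq_trans : transitive simq.
Proof.
move=> q p r /asboolP[a [b ab]] /asboolP[c [d cd]]; apply/asboolP.
exists ((c%:num * a%:num)%R)%:pos, ((b%:num * d%:num)%R)%:pos.
by rewrite -!scaleqA ab scaleqC cd.
Qed.

Canonical simq_equiv := EquivRel simq simq_refl simq_sym simq_trans.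

Definition dimension := {eq_quot simq}.
HB.instance Definition _ : EqQuotient _ simq dimension :=
  EqQuotient.on dimension.
HB.instance Definition _ := Choice.on dimension.

Definition dim_of (q : Q) : dimension := \pi_dimension q.

Lemma dim_ofP (p q : Q) : dim_of p = dim_of q <->
  exists a b : {posnum R}, scaleq a p = scaleq b q.
Proof.
split=> [/eqmodP/asboolP // | pq]; exact/eqmodP/asboolP.
Qed.

Definition dim_mul (D E : dimension) : dimension := dim_of (repr D * repr E).

Lemma dim_mul_of (p q : Q) : dim_of (p * q) = dim_mul (dim_of p) (dim_of q).
Proof.
have /dim_ofP[a [b ab]] : dim_of (repr (dim_of p)) = dim_of p by exact: reprK.
have /dim_ofP[c [d cd]] : dim_of (repr (dim_of q)) = dim_of q by exact: reprK.
apply/esym/dim_ofP.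
exists ((a%:num * c%:num)%R)%:pos, ((b%:num * d%:num)%R)%:pos.
by rewrite -!scaleqA scaleqMr cd scaleqMl ab (scaleqMr d) scaleqMl.
Qed.

Lemma dim_mulA : associative dim_mul.
Proof.
elim/quotW=> x; elim/quotW=> y; elim/quotW=> z.
by rewrite -!/(dim_of _) -!dim_mul_of mulgA.
Qed.

Lemma dim_mul1 : left_id (dim_of 1) dim_mul.
Proof. by elim/quotW=> x; rewrite -!/(dim_of _) -dim_mul_of mul1g. Qed.

Lemma dim_mulr1 : right_id (dim_of 1) dim_mul.
Proof. by elim/quotW=> x; rewrite -!/(dim_of _) -dim_mul_of mulg1. Qed.

HB.instance Definition _ :=
  isMonoid.Build dimension dim_mulA dim_mul1 dim_mulr1.

Lemma dim_of1 : dim_of 1 = 1.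
Proof. by []. Qed.

Lemma dim_ofM (p q : Q) : dim_of (p * q) = dim_of p * dim_of q.
Proof. exact: dim_mul_of. Qed.

Definition elt (D : dimension) := {q : Q | dim_of q == D}.

(* The root with respect to D: the p in D with p ^+ k = x, which exists and *)
(* is unique when 0 < k, x lies in D ^+ k and Q is a quantity space. *)
Definition qroot (D : dimension) (k : nat) (x : Q) : Q :=
  xget 1 [set p | dim_of p = D /\ p ^+ k = x].

Definition dimension_group (H : set dimension) :=
  [/\ H 1, forall d e, H d -> H e -> H (d * e) & forall d, H d -> H (minv d)].

Definition generated_group (A : set dimension) : set dimension :=
  smallest dimension_group A.

Definition dependent (n : nat) (d : 'I_n -> dimension) (e : dimension) :=
  exists (k : int) (ks : 'I_n -> int),
    k <> 0%R /\ e ^z k = \prod_(i < n) d i ^z ks i.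

Definition independent (n : nat) (d : 'I_n -> dimension) :=
  forall ks : 'I_n -> int,
    \prod_(i < n) d i ^z ks i = 1 -> forall i, ks i = 0%R.

Definition maximal_independent (T : set dimension) (n : nat)
    (d : 'I_n -> dimension) :=
  [/\ forall i, T (d i), independent d &
      forall e, T e -> (forall i, e <> d i) -> dependent d e].

(* The factors of the domain are indexed by a finite type, so that a domain *)
(* made of two lists of dimensions can be indexed by a sum type. *)
Definition quantity_fun (I : finType) (E : I -> dimension) (E0 : dimension) :=
  (forall i, elt (E i)) -> elt E0.

Definition dim_cat (I J : finType) (D : I -> dimension) (B : J -> dimension)
    (i : I + J) : dimension :=
  match i with inl a => D a | inr b => B b end.

(* No scalar in {posnum R} is zero, so no quantity function is trivial. *)
Definition trivial_fun (I : finType) (E : I -> dimension) (E0 : dimension)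
    (Phi : quantity_fun E E0) :=
  exists (z : {posnum R}) (q : Q),
    z%:num = 0%R /\ forall x, val (Phi x) = scaleq z q.

Definition covariant_rep (I : finType) (E : I -> dimension) (E0 : dimension)
    (Phi : quantity_fun E E0) (phi : (I -> {posnum R}) -> {posnum R}) :=
  forall (x : forall i, elt (E i)) (b : basis Q),
    phi (fun i => measure_of b (val (x i))) = measure_of b (val (Phi x)).

End Dimensions.

(* Main.v *)
Require Import Defs.
From mathcomp Require Import all_boot all_order all_algebra generic_quotient.
From mathcomp Require Import all_classical all_reals all_analysis.

Set Implicit Arguments.
Unset Strict Implicit.
Unset Printing Implicit Defensive.

Import Order.TTheory GRing.Theory Num.Theory.

Local Open Scope ring_scope.
Local Open Scope group_scope.
Local Open Scope classical_set_scope.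

(* After a choice of basis, the logarithm of the measure together with the    *)
(* integer vector of exponents are additive coordinates on Q, and rescaling   *)
(* the basis by exp(v_l) changes the logarithm of a measure by minus the      *)
(* pairing of v with the exponents. Covariance thus says that f = ln psi o    *)
(* exp satisfies f(w - <v, e>) = f(w) - <v, e_0> for every v. If e_0 were not *)
(* in the rational span of the exponents of the B_j, some v would vanish on   *)
(* all arguments but not on e_0, which is absurd; so D0^k is a product of     *)
(* powers of the B_j. As the B_j are independent, v can be chosen to send all *)
(* t_j to 1, and f is determined by its values on the remaining arguments.    *)

(** For a fixed basis [b], the pair ([lnm b], [expo b]) is additive and injective on Q ([coord_mul],
    [coord_inj]), and two quantities have the same dimension exactly when their exponents agree
    ([dim_of_expo]). Multiplicative statements thus become linear: by maximality some positive
    multiple of the exponent vector of each D_i is an integral combination of those of the B_j, and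
    the latter are independent over the integers.

    The bases obtained from [b] by rescaling its elements already give the translation law
    ([covariant_rep_translation]). Rational separation then produces k and the k_j
    ([covariant_codomain_dependent]), and normalizing the t_j to 1 produces a function F of the
    logarithms of the pi_i ([log_pi_factorization]). Conjugating F by the logarithm gives phi; Phi
    multiplies the unit of Q by phi of the measures of the Pi_i. The k-th root contributes the sum
    of the (k_j / k) ln t_j, since taking it divides the logarithm of the measure by k. *)

Section IntegerLinearAlgebra.
Variables (n r : nat) (e : 'I_r -> 'I_n -> int).

Let A : 'M[rat]_(r, n) := (\matrix_(j, l) (e j l)%:~R)%R.

Lemma common_denominator (u : 'I_r -> rat) :
  exists (k : nat) (ks : 'I_r -> int), (0 < k)%N /\
    forall j, (k%:R * u j = (ks j)%:~R)%R.
Proof.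
pose k := (\prod_(j < r) `|denq (u j)|)%N.
exists k, (fun j => (\prod_(i < r | i != j) `|denq (u i)|)%N%:Z * numq (u j))%R.
split=> [|j]; first by rewrite prodn_gt0 // => j; rewrite absz_gt0 denq_neq0.
rewrite /k (bigD1 j) //= intrM natrM -{2}[u j]divq_num_den.
have -> : (`|denq (u j)|%:R = (denq (u j))%:~R :> rat)%R.
  by rewrite -[in RHS](gez0_abs (denq_ge0 (u j))).
by rewrite mulrAC [X in (X * _)%R]mulrC divfK ?intr_eq0 ?denq_neq0 // mulrC.
Qed.

(** Clearing denominators turns independence over the integers into independence over the rationals,
    so the matrix [A] of the [e j] has a rational right inverse [C]. Its image in [R] sends [w] to a
    solution [v]. *)
Lemma independent_rational_solution (R : realFieldType) (w : 'I_r -> R) :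
  (forall ks : 'I_r -> int,
     (forall l, \sum_j ks j * e j l = 0)%R -> forall j, ks j = 0%R) ->
  exists v : 'I_n -> R, forall j, (\sum_l v l * (e j l)%:~R = w j)%R.
Proof.
move=> indep.
have /row_freeP[C AC] : row_free A.
  apply: inj_row_free => u uA; apply/rowP => j; rewrite mxE.
  have [k [ks [k_gt0 ksE]]] := common_denominator (u 0%R).
  have ks0 : ks j = 0%R.
    apply: indep => l; apply: (@intr_inj rat).
    rewrite rmorph_sum rmorph0 /=; have /rowP/(_ l) := uA; rewrite !mxE => uAl.
    rewrite -[RHS](mulr0 k%:R) -[in RHS]uAl mulr_sumr; apply: eq_bigr => i _.
    by rewrite intrM -ksE mxE mulrA.
  have /eqP := ksE j; rewrite ks0 mulf_eq0 pnatr_eq0.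
  by rewrite eqn0Ngt k_gt0 /= => /eqP.
exists (fun l => \sum_i ratr (C l i) * w i)%R => j.
under eq_bigr do rewrite mulr_suml.
rewrite exchange_big /= (bigD1 j) //= [X in (_ + X)%R]big1 ?addr0 => [|i ij].
  have /matrixP/(_ j j) := AC; rewrite !mxE eqxx => /(congr1 (@ratr R)).
  rewrite rmorph_sum rmorph1 /= => AC1; rewrite -[RHS]mul1r -[in RHS]AC1 mulr_suml.
  by apply: eq_bigr => l _; rewrite rmorphM mxE /= ratr_int mulrC mulrA.
have /matrixP/(_ j i) := AC; rewrite !mxE eq_sym (negPf ij).
move/(congr1 (@ratr R)); rewrite rmorph_sum rmorph0 /= => AC0.
rewrite -[RHS](mul0r (w i)) -[in RHS]AC0 mulr_suml.
by apply: eq_bigr => l _; rewrite rmorphM mxE /= ratr_int mulrC mulrA.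
Qed.

(** Either [e0] lies in the rational row space of [A], or some column of the cokernel matrix is a
    functional that kills the rows but not [e0]. *)
Lemma dependent_or_separated (e0 : 'I_n -> int) :
  (exists (k : nat) (ks : 'I_r -> int), (0 < k)%N /\
    forall l, e0 l *+ k = \sum_j ks j * e j l)%R \/
  (exists v : 'I_n -> rat, (forall j, \sum_l v l * (e j l)%:~R = 0)%R /\
    (\sum_l v l * (e0 l)%:~R != 0)%R).
Proof.
pose a : 'rV[rat]_n := (\row_l (e0 l)%:~R)%R.
have [/submxP[u au] | a_free] := boolP (a <= A)%MS.
  left; have [k [ks [k_gt0 ksE]]] := common_denominator (u 0%R).
  exists k, ks; split=> // l; apply: (@intr_inj rat).
  have /rowP/(_ l) := au; rewrite !mxE rmorphMn /= -mulr_natl => ->.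
  rewrite mulr_sumr rmorph_sum /=; apply: eq_bigr => i _.
  by rewrite intrM -ksE mxE mulrA.
right; have /rV0Pn[i ai] : (a *m cokermx A != 0)%R by rewrite -submxE.
exists (fun l => cokermx A l i); split=> [j|].
  have /matrixP/(_ j i) := mulmx_coker A; rewrite !mxE => uA.
  by rewrite -[RHS]uA; apply: eq_bigr => l _; rewrite [A j l]mxE mulrC.
apply: contraNneq ai => u0; rewrite mxE; apply/eqP; rewrite -[RHS]u0.
by apply: eq_bigr => l _; rewrite [a _ _]mxE mulrC.
Qed.

End IntegerLinearAlgebra.

(* The Pi theorem in logarithmic coordinates: a change of units translates    *)
(* each argument w i of f by the pairing of v with the exponents of slot i.   *)
Section LogarithmicPiTheorem.
Variables (R : realType) (n m r : nat).
Variables (eD : 'I_m -> 'I_n -> int) (eB : 'I_r -> 'I_n -> int).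
Variable e0 : 'I_n -> int.
Variables (c : 'I_m -> nat) (cc : 'I_m -> 'I_r -> int).
Variable f : ('I_m + 'I_r -> R) -> R.

Let ecat (i : 'I_m + 'I_r) := match i with inl a => eD a | inr j => eB j end.

Local Open Scope ring_scope.

Hypothesis c_gt0 : forall i, (0 < c i)%N.
Hypothesis eDB : forall i l, eD i l *+ c i = \sum_j cc i j * eB j l.
Hypothesis eB_indep : forall ks : 'I_r -> int,
  (forall l, \sum_j ks j * eB j l = 0) -> forall j, ks j = 0.
Hypothesis f_cov : forall (v : 'I_n -> R) w,
  f (fun i => w i - \sum_l v l * (ecat i l)%:~R)
    = f w - \sum_l v l * (e0 l)%:~R.

Lemma pairing_combination (v : 'I_n -> R) (g : 'I_n -> int) (k : nat)
    (ks : 'I_r -> int) : (forall l, g l *+ k = \sum_j ks j * eB j l) ->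
  (\sum_l v l * (g l)%:~R) *+ k
    = \sum_j (ks j)%:~R * (\sum_l v l * (eB j l)%:~R).
Proof.
move=> gk; rewrite -sumrMnl; under [RHS]eq_bigr do rewrite mulr_sumr.
rewrite exchange_big /=; apply: eq_bigr => l _.
rewrite -mulrnAr -rmorphMn /= gk rmorph_sum mulr_sumr /=.
by apply: eq_bigr => j _; rewrite intrM mulrCA.
Qed.

Lemma covariant_codomain_dependent :
  exists (k : nat) (ks : 'I_r -> int), (0 < k)%N /\
    forall l, e0 l *+ k = \sum_j ks j * eB j l.
Proof.
have [//|[u [uB u0]]] := dependent_or_separated eB e0; exfalso.
pose v l : R := ratr (u l).
have vB j : \sum_l v l * (eB j l)%:~R = 0.
  have := congr1 (@ratr R) (uB j); rewrite rmorph_sum rmorph0 /= => uBj.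
  by rewrite -[RHS]uBj; apply: eq_bigr => l _; rewrite rmorphM /= ratr_int.
have vD i : \sum_l v l * (eD i l)%:~R = 0.
  have /eqP := pairing_combination v (eDB i).
  rewrite [X in _ == X]big1 => [|j _]; last by rewrite vB mulr0.
  by rewrite mulrn_eq0 eqn0Ngt c_gt0 /= => /eqP.
(* Translation by [v] fixes every point, in particular 0, yet should change the value of [f] by the
   nonzero pairing with [e0]. *)
have /eqP := f_cov v (fun=> 0).
have -> : (fun i => 0 - \sum_l v l * (ecat i l)%:~R) = (fun=> 0).
  by apply/funext => -[i|j]; rewrite /= ?vD ?vB subr0.
rewrite -subr_eq0 opprB addrC subrK.
have -> : \sum_l v l * (e0 l)%:~R = ratr (\sum_l u l * (e0 l)%:~R).
  by rewrite rmorph_sum; apply: eq_bigr => l _; rewrite rmorphM /= ratr_int.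
by rewrite fmorph_eq0 (negPf u0).
Qed.

Lemma log_pi_factorization (k : nat) (ks : 'I_r -> int) : (0 < k)%N ->
  (forall l, e0 l *+ k = \sum_j ks j * eB j l) ->
  exists F : ('I_m -> R) -> R, forall w, f w =
    \sum_j (ks j)%:~R / k%:R * w (inr j)
    + F (fun i => w (inl i) *+ c i - \sum_j (cc i j)%:~R * w (inr j)).
Proof.
move=> k_gt0 e0B.
(* [F] reads [f] where the last r arguments are 0. Dividing by [c a] undoes the multiplication by
   [c a] in the logarithm of pi_a. *)
exists (fun z => f (fun i => match i with inl a => z a / (c a)%:R | inr _ => 0 end)).
move=> w.
(* This change of units brings every [w (inr j)] to 0. *)
have [v vB] := independent_rational_solution (fun j => w (inr j)) eB_indep.
have kR : k%:R != 0 :> R by rewrite pnatr_eq0 -lt0n.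
have -> : \sum_j (ks j)%:~R / k%:R * w (inr j) = \sum_l v l * (e0 l)%:~R.
  apply: (mulfI kR); rewrite [in RHS]mulr_natl (pairing_combination v e0B).
  rewrite mulr_sumr; apply: eq_bigr => j _.
  by rewrite vB mulrA mulrCA mulfV ?mulr1.
apply/eqP; rewrite addrC -subr_eq -f_cov; apply/eqP; congr f.
apply/funext => -[i|j] /=; last by rewrite vB subrr.
have cR : (c i)%:R != 0 :> R by rewrite pnatr_eq0 -lt0n.
apply: (mulfI cR); rewrite [RHS]mulrC divfK // mulrBr !mulr_natl.
rewrite (pairing_combination v (eDB i)); congr (_ - _).
by apply: eq_bigr => j _; rewrite vB.
Qed.

End LogarithmicPiTheorem.

(** * The logarithm as an isomorphism from positive scalars to the additive reals *)

Section PositiveLogarithm.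
Variable R : realType.
Local Open Scope ring_scope.

Definition lnp (a : {posnum R}) : R := ln a%:num.
Definition expp (x : R) : {posnum R} := PosNum (expR_gt0 x).

Lemma lnpK : cancel lnp expp.
Proof. by move=> a; apply/val_inj; rewrite /= lnK // posrE. Qed.

Lemma exppK : cancel expp lnp.
Proof. by move=> x; rewrite /lnp /= expRK. Qed.

Lemma lnpM (a b : {posnum R}) : lnp (a%:num * b%:num)%:pos = lnp a + lnp b.
Proof. by rewrite /lnp /= lnM // posrE. Qed.

Lemma lnp1 : lnp 1%:pos = 0.
Proof. by rewrite /lnp /= ln1. Qed.

Lemma lnp_prod n (g : 'I_n -> {posnum R}) :
  lnp (scalar_prod g) = \sum_j lnp (g j).
Proof.
rewrite /lnp /=; elim: n g => [|n IHn] g; first by rewrite !big_ord0 ln1.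
by rewrite !big_ord_recl lnM ?IHn // posrE // prodr_gt0.
Qed.

Lemma ln_exprz (x : R) (k : int) : 0 < x -> ln (x ^ k) = k%:~R * ln x.
Proof.
by move=> x0; rewrite -powR_intmul ?ln_powR // ltW.
Qed.

End PositiveLogarithm.

(** * Integer powers in a monoid and their images under additive maps *)

Section IntegerPowers.
Variable M : monoidType.
Implicit Types x y : M.

Lemma mexpzS x (k : int) : invertible x -> x ^z (k + 1)%R = x * x ^z k.
Proof.
move=> /minvP[xV Vx]; case: k => [k|[|k]].
- by rewrite addrC -intS /= expgS.
- by rewrite /= expg0 expg1 xV.
rewrite NegzE intS opprD addrAC addNr add0r -NegzE /=.
by rewrite [in RHS]expgS mulgA xV mul1g.
Qed.

Lemma mexpzD x (k l : int) : invertible x -> x ^z (k + l)%R = x ^z k * x ^z l.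
Proof.
move=> xI; elim/int_rect: k => [|k IHk|k IHk].
- by rewrite add0r mul1g.
- by rewrite intS -addrA ![(1 + _)%R]addrC !mexpzS // IHk mulgA.
have [xV Vx] := minvP xI.
(* Inserting [minv x * x] on both sides lets [mexpzS] raise each exponent by one, which reduces to
   the induction hypothesis. *)
rewrite -[LHS]mul1g -[in RHS](mul1g (x ^z _)) -Vx -!mulgA [x * (_ * _)]mulgA.
have kS : (- k.+1%:Z + 1 = - k%:Z)%R by rewrite intS opprD addrAC addNr add0r.
by rewrite -!mexpzS // addrAC kS IHk.
Qed.

Section Morphism.
Variables (V : zmodType) (f : M -> V).
Hypothesis fM : forall x y, f (x * y) = (f x + f y)%R.

Lemma morph_one : f 1 = 0%R.
Proof. by apply: (addrI (f 1)); rewrite -fM mulg1 addr0. Qed.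

Lemma morph_expg x n : f (x ^+ n) = (f x *+ n)%R.
Proof. by elim: n => [|n IHn]; rewrite ?morph_one // expgS fM IHn mulrS. Qed.

Lemma morph_minv x : invertible x -> f (minv x) = (- f x)%R.
Proof.
by move=> /minvP[xV _]; apply/eqP; rewrite -addr_eq0 addrC -fM xV morph_one.
Qed.

Lemma morph_mexpz x (k : int) : invertible x -> f (x ^z k) = (f x *~ k)%R.
Proof.
case: k => n xI; rewrite /= morph_expg //.
by rewrite morph_minv // mulNrn NegzE mulrNz.
Qed.

(** Serves for the three additive maps [lnm b], [expo b] and [dim_expo b]. *)
Lemma morph_prod_mexpz n (x : 'I_n -> M) (k : 'I_n -> int) :
  (forall i, invertible (x i)) ->
  f (\prod_(i < n) x i ^z k i) = (\sum_i f (x i) *~ k i)%R.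
Proof.
move=> xI; rewrite (big_morph f fM morph_one).
by apply: eq_bigr => i _; rewrite morph_mexpz.
Qed.

End Morphism.
End IntegerPowers.

(** * Logarithmic measure and exponents relative to a basis *)

Section Coordinates.
Variables (R : realType) (Q : scalableMonoidType R).
Implicit Types (b : Defs.basis Q) (q : Q) (a : {posnum R}).

Lemma prodqM n (x y : 'I_n -> Q) :
  \prod_(i < n) (x i * y i) = (\prod_(i < n) x i) * \prod_(i < n) y i.
Proof.
elim: n x y => [|n IHn] x y; first by rewrite !big_ord0 mulg1.
rewrite !big_ord_recl IHn -!mulgA; congr (_ * _).
by rewrite mulgA (Defs.mulqC (y ord0)) -mulgA.
Qed.

Lemma scaleq_invertible a q : invertible q -> invertible (scaleq a q).
Proof.
(* [expp (- lnp a)] is the inverse of the scalar [a]. *)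
move=> [q' [qq' q'q]]; exists (scaleq (expp (- lnp a)) q').
have aV : (a%:num * (expp (- lnp a))%:num)%:pos%R = 1%:pos%R.
  by apply: (can_inj (@lnpK R)); rewrite lnpM exppK subrr lnp1.
have E : scaleq a q * scaleq (expp (- lnp a)) q' = 1.
  by rewrite -scaleqMl scaleqMr scaleqA aV scale1q.
by split=> //; rewrite Defs.mulqC.
Qed.

Section OneBasis.
Variable b : Defs.basis Q.

Definition unit_of (e : {ffun 'I_(basis_size b) -> int}) : Q :=
  \prod_(i < basis_size b) basis_elt i ^z e i.

Definition expo q : {ffun 'I_(basis_size b) -> int} :=
  (projT1 (cid (basis_expansion b q))).2.

Definition lnm q : R := lnp (measure_of b q).

Lemma expansionE q : q = scaleq (measure_of b q) (unit_of (expo q)).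
Proof. by rewrite /measure_of /expo; case: cid => e [/= qe _]. Qed.

Lemma expansion_unique a e :
  measure_of b (scaleq a (unit_of e)) = a /\ expo (scaleq a (unit_of e)) = e.
Proof.
rewrite /measure_of /expo; case: cid => ae [/= _ ae_uniq].
by rewrite (ae_uniq (a, e)).
Qed.

Lemma unit_ofD e f : unit_of (e + f)%R = unit_of e * unit_of f.
Proof.
rewrite /unit_of -prodqM; apply: eq_bigr => i _.
by rewrite ffunE mexpzD //; exact: basis_invertible.
Qed.

Lemma unit_of0 : unit_of 0%R = 1.
Proof. by rewrite /unit_of big1 // => i _; rewrite ffunE. Qed.

Lemma lnm_scale_unit a e : lnm (scaleq a (unit_of e)) = lnp a.
Proof. by rewrite /lnm (expansion_unique a e).1. Qed.

Lemma expo_scale_unit a e : expo (scaleq a (unit_of e)) = e.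
Proof. exact: (expansion_unique a e).2. Qed.

Lemma coord_inj p q : lnm p = lnm q -> expo p = expo q -> p = q.
Proof.
move=> /(can_inj (@lnpK R)) pq epq.
by rewrite (expansionE p) pq epq -expansionE.
Qed.

Lemma coord_mul p q :
  lnm (p * q) = (lnm p + lnm q)%R /\ expo (p * q) = (expo p + expo q)%R.
Proof.
rewrite {1 3}(expansionE p) {1 3}(expansionE q) -scaleqMl -scaleqMr scaleqA.
by rewrite -unit_ofD lnm_scale_unit expo_scale_unit lnpM.
Qed.

Lemma lnmM p q : lnm (p * q) = (lnm p + lnm q)%R.
Proof. exact: (coord_mul p q).1. Qed.

Lemma expoM p q : expo (p * q) = (expo p + expo q)%R.
Proof. exact: (coord_mul p q).2. Qed.

Lemma lnm_scale a q : lnm (scaleq a q) = (lnp a + lnm q)%R.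
Proof. by rewrite {1}(expansionE q) scaleqA lnm_scale_unit lnpM. Qed.

Lemma expo_scale a q : expo (scaleq a q) = expo q.
Proof. by rewrite {1}(expansionE q) scaleqA expo_scale_unit. Qed.

Lemma quantity_invertible q : invertible q.
Proof.
rewrite (expansionE q); apply: scaleq_invertible.
by exists (unit_of (- expo q)%R); rewrite -!unit_ofD subrr addNr unit_of0.
Qed.

(** Scaling leaves exponents unchanged; conversely, quantities with equal exponents agree after each
    is scaled by the measure of the other. *)
Lemma dim_of_expo p q : dim_of p = dim_of q <-> expo p = expo q.
Proof.
split=> [/dim_ofP[a [a' E]]|pq].
  by rewrite -(expo_scale a p) E expo_scale.
apply/dim_ofP; exists (measure_of b q), (measure_of b p).
rewrite {1}(expansionE p) {2}(expansionE q) pq !scaleqA.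
by congr scaleq; apply/val_inj/mulrC.
Qed.

Definition dim_expo (d : dimension Q) := expo (repr d).

Lemma dim_of_repr (d : dimension Q) : dim_of (repr d) = d.
Proof. exact: reprK. Qed.

Lemma dim_expo_of q : dim_expo (dim_of q) = expo q.
Proof. by apply/dim_of_expo; rewrite dim_of_repr. Qed.

Lemma dim_expo_inj : injective dim_expo.
Proof. by move=> d d' /dim_of_expo; rewrite !dim_of_repr. Qed.

Lemma dim_expoM d d' : dim_expo (d * d') = (dim_expo d + dim_expo d')%R.
Proof. by rewrite dim_expo_of expoM. Qed.

Lemma dimension_invertible (d : dimension Q) : invertible d.
Proof.
have [q [dq qd]] := quantity_invertible (repr d).
exists (dim_of q); rewrite -(dim_of_repr d) -!dim_ofM dq qd.
by rewrite dim_of1.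
Qed.

(** It suffices to exhibit one root, which excludes the default value of [xget]: take the exponents
    of [D] and divide the logarithm of the measure by [k]. *)
Lemma qrootP (D : dimension Q) (k : nat) (y : Q) : (0 < k)%N ->
  dim_of y = D ^+ k -> dim_of (qroot D k y) = D /\ (qroot D k y) ^+ k = y.
Proof.
move=> k_gt0 yD; rewrite /qroot; case: xgetP => [p _ //|noroot].
pose p := scaleq (expp (lnm y / k%:R)%R) (unit_of (dim_expo D)).
case: (noroot p); split.
  by apply: dim_expo_inj; rewrite dim_expo_of expo_scale_unit.
apply: coord_inj; rewrite (morph_expg lnmM, morph_expg expoM).
  by rewrite lnm_scale_unit exppK -[LHS]mulr_natr divfK // pnatr_eq0 -lt0n.
by rewrite expo_scale_unit -dim_expo_of yD (morph_expg dim_expoM).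
Qed.

(** * Change of basis by rescaling the basis elements *)

Section Rescaling.
Variable v : 'I_(basis_size b) -> R.

Let rescaled_elt i := scaleq (expp (v i)) (basis_elt i).

Let pairing (e : 'I_(basis_size b) -> int) := (\sum_l v l * (e l)%:~R)%R.

Lemma rescaled_invertible i : invertible (rescaled_elt i).
Proof. exact: quantity_invertible. Qed.

(** Both sums are the coordinates of [unit_of e], whose measure is 1; this avoids computing the
    coordinates of each basis element. *)
Lemma basis_coord (e : {ffun 'I_(basis_size b) -> int}) :
  (\sum_l lnm (basis_elt l) *~ e l = 0)%R /\
  (\sum_l expo (basis_elt l) *~ e l = e)%R.
Proof.
have inv := @basis_invertible R Q b.
rewrite -(morph_prod_mexpz lnmM _ inv) -(morph_prod_mexpz expoM _ inv).
by rewrite -/(unit_of e) -[unit_of e]scale1q lnm_scale_unit expo_scale_unit lnp1.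
Qed.

Lemma rescaled_unit (e : {ffun 'I_(basis_size b) -> int}) :
  \prod_l rescaled_elt l ^z e l = scaleq (expp (pairing e)) (unit_of e).
Proof.
have [ln0 expe] := basis_coord e.
apply: coord_inj.
  rewrite (morph_prod_mexpz lnmM) ?lnm_scale_unit ?exppK; last first.
    exact: rescaled_invertible.
  under eq_bigr do rewrite lnm_scale exppK mulrzDl.
  rewrite big_split /= ln0 addr0; apply: eq_bigr => l _.
  by rewrite mulrzr.
rewrite (morph_prod_mexpz expoM) ?expo_scale_unit; last first.
  exact: rescaled_invertible.
by rewrite -[RHS]expe; apply: eq_bigr => l _; rewrite expo_scale.
Qed.

(** By [rescaled_unit] the new unit is the old one times exp of the pairing, so the scalar must
    compensate by that factor while the exponents stay the same. This gives existence and uniqueness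
    at once. *)
Lemma rescaled_is_expansion q (ae : {posnum R} * {ffun 'I_(basis_size b) -> int}) :
  is_expansion rescaled_elt q ae <->
  (expp (lnm q - pairing (expo q)), expo q)%R = ae.
Proof.
case: ae => a e; rewrite /is_expansion /= rescaled_unit scaleqA.
split=> [->|[<- <-]].
  by rewrite lnm_scale_unit expo_scale_unit lnpM exppK addrK lnpK.
apply: coord_inj; first by rewrite lnm_scale_unit lnpM !exppK subrK.
by rewrite expo_scale_unit.
Qed.

Lemma rescaled_expansion q : exists! ae, is_expansion rescaled_elt q ae.
Proof.
exists (expp (lnm q - pairing (expo q)), expo q)%R; split.
  exact/rescaled_is_expansion.
by move=> ae /rescaled_is_expansion.
Qed.

Definition rescaled_basis := Basis rescaled_invertible rescaled_expansion.

Lemma measure_rescaled q :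
  lnp (measure_of rescaled_basis q) = (lnm q - \sum_l v l * (expo q l)%:~R)%R.
Proof.
rewrite /measure_of; case: cid => ae [/= /rescaled_is_expansion <- _] /=.
by rewrite exppK.
Qed.

End Rescaling.
End OneBasis.
End Coordinates.

(** * Exponent vectors of dimensions *)

Section DimensionCoordinates.
Variables (R : realType) (Q : scalableMonoidType R) (b : Defs.basis Q).

Lemma ffun_mulrz (T : finType) (g : {ffun T -> int}) (k : int) (t : T) :
  (g *~ k)%R t = (k * g t)%R.
Proof.
by case: k => k; rewrite ?NegzE ?mulrNz ?ffunE -pmulrn ffunMnE ?mulNr
  -mulr_natl natz.
Qed.

Lemma dim_expo_expg (d : dimension Q) k l :
  dim_expo b (d ^+ k) l = (dim_expo b d l *+ k)%R.
Proof. by rewrite (morph_expg (dim_expoM b)) ffunMnE. Qed.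

Lemma dim_expo_prod s (d : 'I_s -> dimension Q) (ks : 'I_s -> int) l :
  dim_expo b (\prod_(j < s) d j ^z ks j) l
    = (\sum_j ks j * dim_expo b (d j) l)%R.
Proof.
rewrite (morph_prod_mexpz (dim_expoM b)) => [|j].
  by rewrite sum_ffunE; apply: eq_bigr => j _; rewrite ffun_mulrz.
exact: dimension_invertible b _.
Qed.

Lemma expo_prod s (q : 'I_s -> Q) (ks : 'I_s -> int) l :
  expo b (\prod_(j < s) q j ^z ks j) l = (\sum_j ks j * expo b (q j) l)%R.
Proof.
rewrite (morph_prod_mexpz (expoM b)) => [|j].
  by rewrite sum_ffunE; apply: eq_bigr => j _; rewrite ffun_mulrz.
exact: quantity_invertible b _.
Qed.

Lemma lnm_prod s (q : 'I_s -> Q) (ks : 'I_s -> int) :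
  lnm b (\prod_(j < s) q j ^z ks j) = (\sum_j (ks j)%:~R * lnm b (q j))%R.
Proof.
rewrite (morph_prod_mexpz (lnmM b)) => [|j].
  by apply: eq_bigr => j _; rewrite mulrzl.
exact: quantity_invertible b _.
Qed.

Lemma dim_of_scale (a : {posnum R}) (q : Q) : dim_of (scaleq a q) = dim_of q.
Proof. by apply/(dim_of_expo b); rewrite expo_scale. Qed.

Lemma independent_expo s (d : 'I_s -> dimension Q) : independent d ->
  forall ks : 'I_s -> int,
    (forall l, \sum_j ks j * dim_expo b (d j) l = 0)%R ->
    forall j, ks j = 0%R.
Proof.
move=> indep ks ks0; apply: indep; apply: (@dim_expo_inj _ _ b).
apply/ffunP => l; rewrite dim_expo_prod ks0.
by rewrite (morph_one (dim_expoM b)) ffunE.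
Qed.

Lemma maximal_independent_expo (T : set (dimension Q)) s
    (d : 'I_s -> dimension Q) (e : dimension Q) :
  maximal_independent T d -> T e ->
  exists k (ks : 'I_s -> int), (0 < k)%N /\
    forall l, (dim_expo b e l *+ k = \sum_j ks j * dim_expo b (d j) l)%R.
Proof.
move=> [_ _ maxT] Te; have [[i ->]|noteq] := pselect (exists i, e = d i).
  (* Maximality only speaks of elements other than the [d i]; for [e = d i] the relation is the
     trivial one. *)
  exists 1%N, (fun j => (j == i)%:Z); split=> // l.
  rewrite mulr1n (bigD1 i) //= eqxx mul1r big1 ?addr0 // => j.
  by move=> /negPf->; rewrite mul0r.
have [k [ks [k0 ek]]] : dependent d e.
  by apply: maxT => // i ei; apply: noteq; exists i.
have ekl l : (k * dim_expo b e l = \sum_j ks j * dim_expo b (d j) l)%R.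
  rewrite -dim_expo_prod -ek (morph_mexpz (dim_expoM b)) ?ffun_mulrz //.
  exact: dimension_invertible b _.
(* Multiplying the relation by the sign of [k] makes its left exponent positive. *)
exists `|k|%N, (fun j => Num.sg k * ks j)%R; split.
  by rewrite absz_gt0; apply/eqP.
move=> l; under eq_bigr do rewrite -mulrA.
by rewrite -mulr_sumr -ekl mulrA -abszEsg -mulr_natl natz.
Qed.

(** Every positive scalar is the measure of a quantity of dimension [d], so covariance constrains
    [psi] at every point. *)
Definition elt_of_measure (d : dimension Q) (a : {posnum R}) : elt d.
Proof.
exists (scaleq a (unit_of (dim_expo b d))).
by apply/eqP/(@dim_expo_inj _ _ b); rewrite dim_expo_of expo_scale_unit.
Defined.

Lemma measure_elt d a : measure_of b (val (elt_of_measure d a)) = a.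
Proof. exact: (expansion_unique a (dim_expo b d)).1. Qed.

Lemma expo_elt (d : dimension Q) (q : elt d) : expo b (val q) = dim_expo b d.
Proof. by rewrite -dim_expo_of (eqP (valP q)). Qed.

End DimensionCoordinates.

(** * Passage from covariance to logarithms and back to quantities *)

Lemma covariant_rep_translation (R : realType) (Q : scalableMonoidType R)
    (b : Defs.basis Q) (I : finType) (E : I -> dimension Q) (E0 : dimension Q)
    (Psi : quantity_fun E E0) (psi : (I -> {posnum R}) -> {posnum R}) :
  covariant_rep Psi psi ->
  forall (v : 'I_(basis_size b) -> R) (w : I -> R),
  (lnp (psi (fun i => expp (w i - \sum_l v l * (dim_expo b (E i) l)%:~R)))
   = lnp (psi (fun i => expp (w i))) - \sum_l v l * (dim_expo b E0 l)%:~R)%R.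
Proof.
(* The same quantities [x] are measured in [b] and in the rescaled basis, and the two instances of
   covariance are compared. *)
move=> psiP v w; pose x i := elt_of_measure b (E i) (expp (w i)).
have -> : (fun i => expp (w i)) = (fun i => measure_of b (val (x i))).
  by apply/funext => i; rewrite measure_elt.
have -> : (fun i => expp (w i - \sum_l v l * (dim_expo b (E i) l)%:~R)%R) =
    (fun i => measure_of (rescaled_basis v) (val (x i))).
  apply/funext => i; apply: (can_inj (@lnpK R)).
  by rewrite measure_rescaled expo_elt /lnm measure_elt !exppK.
by rewrite !psiP measure_rescaled expo_elt.
Qed.

Lemma lnp_monomial (R : realType) r (a : {posnum R}) (t : 'I_r -> {posnum R})
    (c : nat) (cc : 'I_r -> int) :
  (lnp ((a%:num ^+ c
         / (scalar_prod (fun j => scalar_expz (t j) (cc j)))%:num)%:pos)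
   = lnp a *+ c - \sum_j (cc j)%:~R * lnp (t j))%R.
Proof.
rewrite [LHS]/lnp ln_div ?posrE // lnXn //; congr (_ - _)%R.
rewrite -[ln _]/(lnp (scalar_prod (fun j => scalar_expz (t j) (cc j)))) lnp_prod.
by apply: eq_bigr => j _; rewrite /lnp /= ln_exprz.
Qed.

Theorem corollary5 (R : realType) (Q : quantitySpaceType R) (m r : nat)
    (D0 : dimension Q) (D : 'I_m -> dimension Q) (B : 'I_r -> dimension Q)
    (hB : maximal_independent (generated_group (range D `|` range B)) B)
    (Psi : quantity_fun (dim_cat D B) D0) (hPsi : ~ trivial_fun Psi)
    (psi : ('I_m + 'I_r -> {posnum R}) -> {posnum R})
    (hpsi : covariant_rep Psi psi) :
  exists (k : nat) (kj : 'I_r -> int)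
         (c : 'I_m -> nat) (cc : 'I_m -> 'I_r -> int),
    [/\ (0 < k)%N, forall i, (0 < c i)%N,
        exists Phi : quantity_fun (fun _ : 'I_m => 1 : dimension Q) (1 : dimension Q),
          forall x : forall i, elt (dim_cat D B i),
            let y := \prod_(j < r) val (x (inr j)) ^z kj j in
            dim_of y = D0 ^+ k /\
            exists P : 'I_m -> elt (1 : dimension Q),
              (forall i, val (P i) = val (x (inl i)) ^+ c i
                * minv (\prod_(j < r) val (x (inr j)) ^z cc i j)) /\
              val (Psi x) = qroot D0 k y * val (Phi P)
      & exists phi : ('I_m -> {posnum R}) -> {posnum R},
          let psi' := fun u : 'I_m + 'I_r -> {posnum R} =>
            ((scalar_prod (fun j : 'I_r =>
                ((u (inr j))%:num `^ ((kj j)%:~R / k%:R))%:pos))%:num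
             * (phi (fun i : 'I_m =>
                  ((u (inl i))%:num ^+ c i
                   / (scalar_prod (fun j : 'I_r =>
                        scalar_expz (u (inr j)) (cc i j)))%:num)%:pos))%:num
            )%R%:pos in
          psi = psi' /\ covariant_rep Psi psi'].
Proof.
have [b] : inhabited (Defs.basis Q) := basis_exists.
pose eD i l := dim_expo b (D i) l; pose eB j l := dim_expo b (B j) l.
have /boolp.choice[c /boolp.choice[cc cP]] i : exists (k : nat) (ks : 'I_r -> int),
    (0 < k)%N /\ forall l, (eD i l *+ k = \sum_j ks j * eB j l)%R.
  apply: maximal_independent_expo hB _ => H [_]; apply.
  by left; exists i.
have c_gt0 i : (0 < c i)%N by have [] := cP i.
have eDB i := (cP i).2.
have eB_indep : forall ks : 'I_r -> int,
    (forall l, \sum_j ks j * eB j l = 0)%R -> forall j, ks j = 0%R.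
  by case: hB => _ indep _; exact: independent_expo.
pose f (w : 'I_m + 'I_r -> R) := lnp (psi (fun i => expp (w i))).
have f_cov (v : 'I_(basis_size b) -> R) w :
    (f (fun i => w i - \sum_l v l *
         ((match i with inl a => eD a | inr j => eB j end) l)%:~R)
     = f w - \sum_l v l * (dim_expo b D0 l)%:~R)%R.
  rewrite /f -(covariant_rep_translation hpsi); congr (lnp (psi _)).
  by apply/funext => -[].
have [k [kj [k_gt0 e0B]]] := covariant_codomain_dependent c_gt0 eDB f_cov.
have [F fF] := log_pi_factorization c_gt0 eDB eB_indep f_cov k_gt0 e0B.
pose phi (z : 'I_m -> {posnum R}) := expp (F (fun i => lnp (z i))).
exists k, kj, c, cc; split=> //; last first.
  exists phi; set psi' := (X in let psi' := X in _); rewrite /=.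
  (* Once the formula is shown to equal [psi], its covariance is the hypothesis on [psi]. *)
  suff <- : psi = psi' by [].
  apply/funext => u; apply: (can_inj (@lnpK R)).
  have -> : lnp (psi u) = f (fun i => lnp (u i)).
    by rewrite /f; congr (lnp (psi _)); apply/funext => i; rewrite lnpK.
  rewrite fF /psi' lnpM lnp_prod exppK; congr (_ + F _)%R.
    by apply: eq_bigr => j _; rewrite [RHS]/lnp /= ln_powR.
  by apply/funext => i; rewrite lnp_monomial.
(* [Phi] transports [phi] to quantities: its value is the element of [1_Q] whose measure is [phi] of
   the measures of the [P i]. *)
have Phi_dim (P : 'I_m -> elt (1 : dimension Q)) :
    dim_of (scaleq (phi (fun i => measure_of b (val (P i)))) (1 : Q)) == 1.
  by rewrite (dim_of_scale b).
exists (fun P => exist (fun q : Q => dim_of q == 1) _ (Phi_dim P)) => x y.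
have yD : dim_of y = D0 ^+ k.
  apply: (@dim_expo_inj _ _ b); apply/ffunP => l.
  rewrite dim_expo_expg e0B dim_expo_of expo_prod.
  by apply: eq_bigr => j _; rewrite expo_elt.
split=> //.
pose Pi i := val (x (inl i)) ^+ c i
  * minv (\prod_(j < r) val (x (inr j)) ^z cc i j).
have lnPi i : lnm b (Pi i) = (lnm b (val (x (inl i))) *+ c i
    - \sum_j (cc i j)%:~R * lnm b (val (x (inr j))))%R.
  rewrite lnmM (morph_expg (lnmM b)) (morph_minv (lnmM b)) ?lnm_prod //.
  exact: quantity_invertible b _.
have Pi_dim i : dim_of (Pi i) == 1.
  apply/eqP/(@dim_expo_inj _ _ b)/ffunP => l.
  rewrite (morph_one (dim_expoM b)) dim_expo_of.
  rewrite expoM (morph_expg (expoM b)) (morph_minv (expoM b)); last first.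
    exact: quantity_invertible b _.
  rewrite !ffunE ffunMnE expo_prod expo_elt [X in (X - _)%R]eDB.
  by under [X in (_ - X)%R]eq_bigr do rewrite expo_elt; rewrite subrr.
exists (fun i => exist (fun q : Q => dim_of q == 1) _ (Pi_dim i)); split=> //=.
have [rootD rootX] := qrootP b k_gt0 yD.
(* The two sides are compared in coordinates: the factorization of [f] settles the measures, and
   both exponent vectors are that of [D0]. *)
apply: (coord_inj (b := b)).
  rewrite lnmM lnm_scale exppK (morph_one (lnmM b)) addr0.
  rewrite {1}/lnm -hpsi.
  have -> : lnp (psi (fun i => measure_of b (val (x i))))
      = f (fun i => lnm b (val (x i))).
    by rewrite /f; congr (lnp (psi _)); apply/funext => i; rewrite lnpK.
  rewrite fF; congr (_ + F _)%R; last by apply/funext => i; rewrite -lnPi.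
  have kR : (k%:R != 0 :> R)%R by rewrite pnatr_eq0 -lt0n.
  (* The root is known only through its k-th power, so the logarithms are compared after
     multiplication by [k]. *)
  apply: (mulfI kR); rewrite [RHS]mulr_natl -(morph_expg (lnmM b)) rootX.
  rewrite lnm_prod mulr_sumr; apply: eq_bigr => j _.
  by rewrite mulrA mulrCA mulfV ?mulr1.
rewrite expoM expo_scale (morph_one (expoM b)) addr0 expo_elt.
by rewrite -dim_expo_of rootD.
Qed.
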